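(* Let $M$ and $N$ be matroids with $E(M)\cap E(N)=\{p\}$, where $p$ is neither a loop nor a bridge in either matroid. Suppose $M$ has cycle system $\mathcal{C}=\{C_1,\dots,C_g\}$ and $N$ has cycle system $\mathcal{D}=\{D_1,\dots,D_f\}$. Suppose that $p\in C_1\cap D_1$ and $p\in\mathcal{C}_{[g]}$. Let $\widetilde{\mathcal{C}}=\{C_2,\dots,C_g\}$ and $\widetilde{\mathcal{D}}=\{\widetilde{D}_1,\dots,\widetilde{D}_f\}$, where $$\widetilde{D}_i=\begin{cases} D_i & \text{if } p\notin D_i,\\ (C_1\cup D_i)\setminus\{p\} & \text{if } p\in D_i.\end{cases}$$ Then $\widetilde{\mathcal{C}}\cup\widetilde{\mathcal{D}}$ is a cycle system for the 2-sum $M\oplus_2 N$ along $p$.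
   Context: Matroids are on finite ground sets; $g(M)=|E(M)|-r(M)$ is the corank. A *cycle* of a matroid is a union of circuits. A *bridge* is a coloop. $\mathrm{Cir}(M)$ is the set of circuits of $M$. Unique union: for a family $\mathcal{A}=\{A_1,\dots,A_g\}$ of subsets of a set and $\sigma\subseteq[g]=\{1,\dots,g\}$, $\mathcal{A}_\sigma$ is the set of elements $e\in\bigcup_{i\in\sigma}A_i$ for which there is exactly one $i\in\sigma$ with $e\in A_i$. A *cycle system* for $M$ is a collection $\mathcal{C}=\{C_1,\dots,C_g\}$ of cycles of $M$ with $g=g(M)$ such that for every nonempty $\sigma\subseteq[g]$ the unique union $\mathcal{C}_\sigma$ is dependent in $M$. The *parallel connection* $M\parallel_p N$ is the matroid on $E(M)\cup E(N)$ with circuits $\mathrm{Cir}(M)\cup\mathrm{Cir}(N)\cup\{(C\cup D)\setminus\{p\}: p\in C\in\mathrm{Cir}(M),\ p\in D\in\mathrm{Cir}(N)\}$. The *2-sum* along $p$ is $M\oplus_2 N=(M\parallel_p N)\setminus p$ (deletion of $p$). *)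

(* Defs.v *)
From mathcomp Require Import all_boot.

Set Implicit Arguments.
Unset Strict Implicit.
Unset Printing Implicit Defensive.

(* Ground sets are finite subsets of an ambient finite type, so that two
   matroids can share some, but not all, of their elements. *)
Record matroid (T : finType) := Matroid {
  ground : {set T};
  circuits : {set {set T}};
  circuit_sub_ground : forall C, C \in circuits -> C \subset ground;
  set0_notin_circuits : set0 \notin circuits;
  circuit_antichain :
    forall C D, C \in circuits -> D \in circuits -> C \subset D -> C = D;
  circuit_elimination :
    forall C D e, C \in circuits -> D \in circuits -> C != D ->
      e \in C :&: D ->
      exists2 B, B \in circuits & B \subset (C :|: D) :\ e
}.

Section MatroidNotions.

Variables (T : finType) (M : matroid T).
Implicit Types (A : {set T}) (e : T).

Definition indep A : bool :=
  (A \subset ground M) && [forall C in circuits M, ~~ (C \subset A)].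

Definition dependent A : bool := (A \subset ground M) && ~~ indep A.

Definition basis A : bool := maxset indep A.

Definition rank : nat := \max_(A : {set T} | indep A) #|A|.

Definition corank : nat := #|ground M| - rank.

Definition loop e : bool := [set e] \in circuits M.

Definition bridge e : bool :=
  (e \in ground M) && [forall (B | basis B), e \in B].

(* The empty union is allowed here; members of a cycle system are nonempty
   anyway, since singleton index sets must have dependent unique unions. *)
Definition matroid_cycle A : Prop :=
  exists2 S : {set {set T}}, S \subset circuits M & A = cover S.

End MatroidNotions.

Definition unique_union (T I : finType) (A : I -> {set T}) (s : {set I}) :
    {set T} :=
  [set e | #|[set i in s | e \in A i]| == 1].

(* I plays the role of [g], with g = #|I|; a general finite index type makes
   it easy to juxtapose two families, indexed by a sum type. *)
Definition cycle_system (T I : finType) (M : matroid T) (C : I -> {set T}) :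
    Prop :=
  [/\ #|I| = corank M,
      forall i, matroid_cycle M (C i)
    & forall s : {set I}, s != set0 -> dependent M (unique_union C s)].

Section Deletion.

Variables (T : finType) (M : matroid T) (p : T).

Let del_circuits := [set C in circuits M | p \notin C].

Fact del_sub_ground C : C \in del_circuits -> C \subset ground M :\ p.
Proof.
by rewrite inE => /andP[/circuit_sub_ground CM pC]; rewrite subsetD1 CM.
Qed.

Fact del_set0 : set0 \notin del_circuits.
Proof. by rewrite inE (negPf (set0_notin_circuits M)). Qed.

Fact del_antichain C D :
  C \in del_circuits -> D \in del_circuits -> C \subset D -> C = D.
Proof.
by rewrite !inE => /andP[CM _] /andP[DM _]; apply: circuit_antichain CM DM.
Qed.

Fact del_elimination C D e :
  C \in del_circuits -> D \in del_circuits -> C != D -> e \in C :&: D ->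
  exists2 B, B \in del_circuits & B \subset (C :|: D) :\ e.
Proof.
rewrite !inE => /andP[CM pC] /andP[DM pD] neCD eCD.
have [|B BM sB] := circuit_elimination CM DM neCD (e := e).
  by rewrite inE.
exists B => //; rewrite inE BM; apply/negP => /(subsetP sB).
by rewrite !inE (negPf pC) (negPf pD) andbF.
Qed.

Definition deletion : matroid T :=
  Matroid del_sub_ground del_set0 del_antichain del_elimination.

End Deletion.

Definition parallel_circuits (T : finType) (M N : matroid T) (p : T) :
    {set {set T}} :=
  circuits M :|: circuits N :|:
  [set (C :|: D) :\ p | C in [set C in circuits M | p \in C],
                        D in [set D in circuits N | p \in D]].

Section ParallelFacts.

Variables (T : finType) (p : T).
Implicit Types (M N : matroid T) (A B C D : {set T}).

Lemma parallel_circuitsC M N :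
  parallel_circuits M N p = parallel_circuits N M p.
Proof.
rewrite /parallel_circuits [circuits N :|: _]setUC; congr (_ :|: _).
by apply/setP => A; apply/imset2P/imset2P => -[C D CP DP ->];
  exists D C => //; rewrite setUC.
Qed.

Lemma parallel_mixed M N C D :
  C \in circuits M -> p \in C -> D \in circuits N -> p \in D ->
  (C :|: D) :\ p \in parallel_circuits M N p.
Proof.
move=> CM pC DN pD; rewrite inE; apply/orP; right.
by apply/imset2P; exists C D; rewrite ?inE ?CM ?DN.
Qed.

Lemma parallel_left M N C :
  C \in circuits M -> C \in parallel_circuits M N p.
Proof. by move=> CM; rewrite !inE CM. Qed.

Lemma parallel_right M N D :
  D \in circuits N -> D \in parallel_circuits M N p.
Proof. by move=> DN; rewrite !inE DN orbT. Qed.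

Variant parallel_spec M N A : Prop :=
| ParallelLeft of A \in circuits M
| ParallelRight of A \in circuits N
| ParallelMixed C D of C \in circuits M & p \in C & D \in circuits N
    & p \in D & A = (C :|: D) :\ p.

Lemma parallelP M N A :
  A \in parallel_circuits M N p -> parallel_spec M N A.
Proof.
rewrite !inE -orbA => /or3P[AM|AN|/imset2P[C D]].
- exact: ParallelLeft.
- exact: ParallelRight.
rewrite !inE => /andP[CM pC] /andP[DN pD] ->.
exact: ParallelMixed CM pC DN pD _.
Qed.

Lemma common_eq M N e : ground M :&: ground N = [set p] ->
  e \in ground M -> e \in ground N -> e = p.
Proof.
by move=> MNp eM eN; apply/set1P; rewrite -MNp inE eM.
Qed.

Lemma circuit_in M C e : C \in circuits M -> e \in C -> e \in ground M.
Proof. by move=> /circuit_sub_ground/subsetP; apply. Qed.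

Lemma circuit_neq0 M C : C \in circuits M -> exists e, e \in C.
Proof.
move=> CM; apply/set0Pn; apply: contraTneq CM => ->.
exact: set0_notin_circuits.
Qed.

Lemma nonloop_other M C : ~~ loop M p -> C \in circuits M ->
  exists2 e, e \in C & e != p.
Proof.
move=> pM CM; case: (pickP [pred e in C | e != p]) => [e /andP[]|C0].
  by exists e.
case/negP: pM; rewrite /loop; suff <- : C = [set p] by [].
have sub e : e \in C -> e = p.
  by move=> eC; have /negbT := C0 e; rewrite /= eC negbK => /eqP.
have [e eC] := circuit_neq0 CM; apply/setP => x; rewrite !inE.
by apply/idP/eqP => [/sub//|->]; rewrite -(sub e eC).
Qed.

Lemma mixed_left_sub M N C D C' D' : ground M :&: ground N = [set p] ->
  C \in circuits M -> p \in C' -> D' \in circuits N ->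
  (C :|: D) :\ p \subset (C' :|: D') :\ p -> C \subset C'.
Proof.
move=> MNp CM pC' DN' sub; apply/subsetP => e eC.
have [->//|nep] := eqVneq e p.
have /(subsetP sub) : e \in (C :|: D) :\ p by rewrite !inE nep eC.
rewrite !inE nep => /orP[//|eD'].
by case/eqP: nep; apply: common_eq MNp (circuit_in CM eC) (circuit_in DN' eD').
Qed.

Lemma mixed_not_sub_left M N A C D : ground M :&: ground N = [set p] ->
  ~~ loop N p -> A \in circuits M -> D \in circuits N ->
  ~~ ((C :|: D) :\ p \subset A).
Proof.
move=> MNp pN AM DN; have [e eD nep] := nonloop_other pN DN.
apply/negP => /subsetP/(_ e); rewrite !inE nep eD orbT => /(_ isT) eA.
by case/eqP: nep; apply: common_eq MNp (circuit_in AM eA) (circuit_in DN eD).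
Qed.

Lemma left_sub_mixed M N A C D : ground M :&: ground N = [set p] ->
  A \in circuits M -> C \in circuits M -> p \in C -> D \in circuits N ->
  ~~ (A \subset (C :|: D) :\ p).
Proof.
move=> MNp AM CM pC DN; apply/negP => sub.
have pA : p \notin A by apply/negP => /(subsetP sub); rewrite !inE eqxx.
suff /(circuit_antichain AM CM) eAC : A \subset C by rewrite eAC pC in pA.
apply/subsetP => e eA; have := subsetP sub e eA; rewrite !inE.
case/andP=> nep /orP[//|eD].
by case/eqP: nep; apply: common_eq MNp (circuit_in AM eA) (circuit_in DN eD).
Qed.

Lemma left_not_sub_right M N A B : ground M :&: ground N = [set p] ->
  ~~ loop M p -> A \in circuits M -> B \in circuits N -> ~~ (A \subset B).
Proof.
move=> MNp pM AM BN; have [e eA nep] := nonloop_other pM AM.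
apply/negP => /subsetP/(_ e eA) eB; case/eqP: nep.
exact: common_eq MNp (circuit_in AM eA) (circuit_in BN eB).
Qed.

Lemma elim_left_mixed M N A C D e : ground M :&: ground N = [set p] ->
  A \in circuits M -> C \in circuits M -> p \in C ->
  D \in circuits N -> p \in D ->
  e \in A -> e \in (C :|: D) :\ p ->
  exists2 B, B \in parallel_circuits M N p
           & B \subset (A :|: (C :|: D) :\ p) :\ e.
Proof.
move=> MNp AM CM pC DN pD eA; rewrite !inE => /andP[nep eCD].
have eD : e \notin D.
  apply: contra nep => eD; apply/eqP.
  exact: common_eq MNp (circuit_in AM eA) (circuit_in DN eD).
have {eCD} eC : e \in C by rewrite (negPf eD) orbF in eCD.
have useD : p \in A ->
    exists2 B, B \in parallel_circuits M N p
             & B \subset (A :|: (C :|: D) :\ p) :\ e.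
  move=> pA; exists D; first exact: parallel_right.
  apply/subsetP => x xD; rewrite !inE xD orbT andbT.
  have nxe : x != e by apply: contraNneq eD => <-.
  rewrite nxe /=; by have [->|] := eqVneq x p; rewrite ?pA ?orbT.
have [pA|pA] := boolP (p \in A); first exact: useD.
have neAC : A != C by apply: contraNneq pA => ->.
have [|F FM sF] := circuit_elimination AM CM neAC (e := e).
  by rewrite inE eA.
have [pF|pF] := boolP (p \in F).
  exists ((F :|: D) :\ p); first exact: parallel_mixed.
  apply/subsetP => x; rewrite !inE => /andP[nxp /orP[xF|xD]].
    have := subsetP sF x xF; rewrite !inE nxp => /andP[-> /orP[->//|->]].
    by rewrite orbT.
  rewrite nxp xD !orbT andbT; apply: contraNneq eD => <-; exact: xD.
exists F; first exact: parallel_left.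
apply/subsetP => x xF; have nxp : x != p by apply: contraNneq pF => <-.
have := subsetP sF x xF; rewrite !inE nxp => /andP[-> /orP[->//|->]].
by rewrite orbT.
Qed.

Lemma elim_mixed_left M N C D C' D' e : ground M :&: ground N = [set p] ->
  C \in circuits M -> p \in C -> D \in circuits N -> p \in D ->
  C' \in circuits M -> p \in C' -> D' \in circuits N -> p \in D' ->
  (C :|: D) :\ p != (C' :|: D') :\ p -> e != p -> e \in C -> e \in C' ->
  exists2 B, B \in parallel_circuits M N p
           & B \subset ((C :|: D) :\ p :|: (C' :|: D') :\ p) :\ e.
Proof.
move=> MNp CM pC DN pD CM' pC' DN' pD' neq nep eC eC'.
have notN X : X \in circuits N -> e \notin X.
  move=> XN; apply: contra nep => eX; apply/eqP.
  exact: common_eq MNp (circuit_in CM eC) (circuit_in XN eX).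
have [eCC|neC] := eqVneq C C'.
  have neD : D != D' by apply: contraNneq neq => ->; rewrite eCC.
  have [|F FN sF] := circuit_elimination DN DN' neD (e := p).
    by rewrite inE pD.
  exists F; first exact: parallel_right.
  apply/subsetP => x xF; have := subsetP sF x xF; rewrite !inE.
  case/andP=> -> xDD; have -> : x != e.
    by apply: contraTneq xF => ->; apply: notN.
  by case/orP: xDD => ->; rewrite !orbT.
have [|F FM sF] := circuit_elimination CM CM' neC (e := e).
  by rewrite inE eC.
have [pF|pF] := boolP (p \in F).
  exists ((F :|: D) :\ p); first exact: parallel_mixed.
  apply/subsetP => x; rewrite !inE => /andP[nxp /orP[xF|xD]].
    by have := subsetP sF x xF; rewrite !inE nxp => /andP[-> /orP[->|->]];
      rewrite ?orbT.
  have -> /= : x != e by apply: contraNneq (notN _ DN) => <-.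
  by rewrite nxp xD !orbT.
exists F; first exact: parallel_left.
apply/subsetP => x xF; have nxp : x != p by apply: contraNneq pF => <-.
by have := subsetP sF x xF; rewrite !inE nxp => /andP[-> /orP[->|->]];
  rewrite ?orbT.
Qed.

End ParallelFacts.

Section ParallelConnection.

Variables (T : finType) (M N : matroid T) (p : T).
Hypothesis MNp : ground M :&: ground N = [set p].
(* If p is a loop of M or N, the family below need not be an antichain. *)
Hypotheses (pM : ~~ loop M p) (pN : ~~ loop N p).

Let NMp : ground N :&: ground M = [set p].
Proof. by rewrite setIC. Qed.

Fact parallel_sub_ground C :
  C \in parallel_circuits M N p -> C \subset ground M :|: ground N.
Proof.
case/parallelP => [CM|CN|A B AM pA BN pB ->].
- exact: subset_trans (circuit_sub_ground CM) (subsetUl _ _).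
- exact: subset_trans (circuit_sub_ground CN) (subsetUr _ _).
apply: subset_trans (subsetDl _ _) _.
by apply: setUSS; apply: circuit_sub_ground.
Qed.

Fact parallel_set0 : set0 \notin parallel_circuits M N p.
Proof.
apply/negP => /parallelP[CM|CN|A B AM pA BN pB].
- by rewrite (negPf (set0_notin_circuits M)) in CM.
- by rewrite (negPf (set0_notin_circuits N)) in CN.
have [e eA nep] := nonloop_other pM AM.
by move/setP/(_ e); rewrite !inE nep eA.
Qed.

Fact parallel_antichain C D :
  C \in parallel_circuits M N p -> D \in parallel_circuits M N p ->
  C \subset D -> C = D.
Proof.
move=> /parallelP CP /parallelP DP.
case: CP => [CM|CN|A B AM pA BN pB ->];
case: DP => [DM|DN|A' B' AM' pA' BN' pB' ->].
- exact: circuit_antichain CM DM.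
- by rewrite (negPf (left_not_sub_right MNp pM CM DN)).
- by rewrite (negPf (left_sub_mixed MNp CM AM' pA' BN')).
- by rewrite (negPf (left_not_sub_right NMp pN CN DM)).
- exact: circuit_antichain CN DN.
- by rewrite setUC (negPf (left_sub_mixed NMp CN BN' pB' AM')).
- by rewrite (negPf (mixed_not_sub_left _ MNp pN DM BN)).
- by rewrite setUC (negPf (mixed_not_sub_left _ NMp pM DN AM)).
move=> sub.
have /(circuit_antichain AM AM') -> := mixed_left_sub MNp AM pA' BN' sub.
rewrite setUC [A' :|: B']setUC in sub.
by have /(circuit_antichain BN BN') -> := mixed_left_sub NMp BN pB' AM' sub.
Qed.

Fact parallel_elimination C D e :
  C \in parallel_circuits M N p -> D \in parallel_circuits M N p ->
  C != D -> e \in C :&: D ->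
  exists2 B, B \in parallel_circuits M N p & B \subset (C :|: D) :\ e.
Proof.
move=> /parallelP CP /parallelP DP neCD /setIP[eC eD].
have eCD : e \in C :&: D by rewrite inE eC.
case: CP => [CM|CN|A B AM pA BN pB eqC];
case: DP => [DM|DN|A' B' AM' pA' BN' pB' eqD].
- have [F FM sF] := circuit_elimination CM DM neCD eCD.
  by exists F => //; apply: parallel_left.
- have ep := common_eq MNp (circuit_in CM eC) (circuit_in DN eD).
  rewrite ep in eC eD *; exists ((C :|: D) :\ p) => //.
  exact: parallel_mixed.
- by rewrite eqD in eD *; apply: elim_left_mixed.
- have ep := common_eq MNp (circuit_in DM eD) (circuit_in CN eC).
  rewrite ep in eC eD *; exists ((D :|: C) :\ p); last by rewrite setUC.
  exact: parallel_mixed.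
- have [F FN sF] := circuit_elimination CN DN neCD eCD.
  by exists F => //; apply: parallel_right.
- rewrite eqD [A' :|: B']setUC in eD *; rewrite parallel_circuitsC.
  exact: elim_left_mixed.
- by rewrite eqC in eC *; rewrite setUC; apply: elim_left_mixed.
- rewrite eqC [A :|: B]setUC in eC *; rewrite parallel_circuitsC setUC.
  exact: elim_left_mixed.
have nep : e != p by move: eC; rewrite eqC !inE => /andP[].
have eAB : (e \in A) || (e \in B) by move: eC; rewrite eqC !inE nep.
have eAB' : (e \in A') || (e \in B') by move: eD; rewrite eqD !inE nep.
have cross X Y : X \in circuits M -> Y \in circuits N -> e \in X -> e \notin Y.
  move=> XM YN eX; apply: contra nep => eY; apply/eqP.
  exact: common_eq MNp (circuit_in XM eX) (circuit_in YN eY).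
rewrite eqC eqD in neCD *; have [eA|eA] := boolP (e \in A).
  have eA' : e \in A' by move: eAB'; rewrite (negPf (cross _ _ AM BN' eA)) orbF.
  exact: elim_mixed_left.
have eB : e \in B by rewrite (negPf eA) in eAB.
have eB' : e \in B'.
  by case/orP: eAB' => // /(cross _ _ AM' BN); rewrite eB.
rewrite [A :|: B]setUC [A' :|: B']setUC in neCD *; rewrite parallel_circuitsC.
exact: elim_mixed_left.
Qed.

Definition parallel_connection : matroid T :=
  Matroid parallel_sub_ground parallel_set0 parallel_antichain
    parallel_elimination.

Definition two_sum : matroid T := deletion parallel_connection p.

End ParallelConnection.

(* Main.v *)
Require Import Defs.
From mathcomp Require Import all_boot.

(** The corank of the 2-sum is [corank M + corank N - 1]: if [I] is independent
    in the 2-sum then [p] can be added to one of its two halves, since otherwise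
    the two circuits through [p] would combine into a circuit inside [I];
    conversely a basis of [M] containing [p] and a basis of [N] avoiding [p]
    glue, after removing [p], to an independent set.

    For unique unions, [p] lies in no [C i] with [i != 0].  If some [D j] is
    selected, the unique union of the selected [D j] contains a circuit [B] of
    [N].  When [p] is in [B], exactly one selected [D j] contains [p], so on the
    side of [M] the new family behaves like the selected [C i] together with
    [C 0]; the unique union of those contains a circuit of [M], which either
    avoids [p] or combines with [B]. *)

Set Implicit Arguments.
Unset Strict Implicit.
Unset Printing Implicit Defensive.

(** * Independence, rank and cycles from the circuit axioms *)

Section Matroid.

Variables (T : finType) (M : matroid T).
Implicit Types (A B I J K : {set T}) (e : T).

Lemma indepP A :
  reflect (A \subset ground M /\ forall K, K \in circuits M -> ~~ (K \subset A))
          (indep M A).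
Proof.
by apply: (iffP andP) => -[AM circA]; split=> //; apply/forall_inP.
Qed.

Lemma dependentP A :
  reflect (A \subset ground M /\ exists2 K, K \in circuits M & K \subset A)
          (dependent M A).
Proof.
rewrite /dependent /indep; apply: (iffP andP) => -[AM].
  rewrite AM negb_forall_in => /exists_inP[K KM]; rewrite negbK => KA.
  by split=> //; exists K.
case=> K KM KA; rewrite AM negb_forall_in; split=> //.
by apply/exists_inP; exists K; rewrite ?negbK.
Qed.

(** A circuit inside [e |: A] that missed [e] would lie in the independent set [A]. *)
Lemma circuit_sub_setU1 A e : indep M A -> e \in ground M ->
  ~~ indep M (e |: A) ->
  exists2 K, K \in circuits M & e \in K /\ K \subset e |: A.
Proof.
move=> /indepP[AM circA] eM depA.
have /dependentP[_ [K KM KA]] : dependent M (e |: A).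
  by rewrite /dependent depA andbT subUset sub1set eM.
exists K => //; split=> //; apply: contraNT (circA K KM) => eK.
by apply/subsetP => x xK; have /setU1P[xe|//] := subsetP KA x xK;
  rewrite xe (negPf eK) in xK.
Qed.

Lemma indepS A B : A \subset B -> indep M B -> indep M A.
Proof.
move=> AB /indepP[BM circB]; apply/indepP; split; first exact: subset_trans BM.
by move=> K /circB; apply: contra => /subset_trans; apply.
Qed.

Lemma indep_augment I J : indep M I -> indep M J -> #|I| < #|J| ->
  exists2 x, x \in J :\: I & indep M (x |: I).
Proof.
move=> indI indJ ltIJ; apply/exists_inP; apply: contraT.
rewrite negb_exists_in => /forall_inP noaug.
(* Among the larger independent sets inside [I :|: J], [L] is closest to [I]. *)
pose P L := [&& indep M L, L \subset I :|: J & #|I| < #|L|].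
have PJ : P J by rewrite /P indJ subsetUr.
case: (arg_minnP (fun L => #|I :\: L|) PJ) => L /and3P[indL subL ltIL] minL.
have /indepP[LM circL] := indL; have /indepP[IM circI] := indI.
(* If [L] contained [I], any point of [L] outside [I] would lie in [J] and augment [I]. *)
have /subsetPn[e eI eL] : ~~ (I \subset L).
  apply/negP => IL; have /subsetPn[x xL xI] : ~~ (L \subset I).
    by apply/negP => /subset_leq_card; rewrite leqNgt ltIL.
  have := noaug x; rewrite inE xI /=.
  have /setUP[|->] := subsetP subL x xL; first by rewrite (negPf xI).
  move=> /(_ isT); rewrite (@indepS _ L) //.
  by rewrite subUset sub1set xL.
(* Trading [x] for [e] keeps the size of [L] but misses fewer elements of [I]. By the choice of [L]
   the result is dependent, so it contains a circuit through [e]. *)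
have exchange x : x \in L :\: I ->
    exists2 K, K \in circuits M & [/\ e \in K, x \notin K & K \subset e |: L].
  case/setDP=> xL xI; have nex : e != x by apply: contraNneq xI => <-.
  have : ~~ indep M (e |: L :\ x).
    apply/negP => ind; have := minL (e |: L :\ x).
    rewrite /P ind cardsU1 !inE (negPf eL) andbF add1n /=.
    rewrite (cardsD1 x L) xL add1n in ltIL; rewrite ltIL andbT.
    rewrite subUset sub1set inE eI (subset_trans (subsetDl _ _) subL).
    move=> /(_ isT); apply/negP; rewrite -ltnNge; apply: proper_card.
    apply/properP; split; last by exists e; rewrite !inE ?eI ?eL ?eqxx.
    apply/subsetP => y; rewrite !inE negb_or => /andP[/andP[nye ny] yI].
    rewrite yI andbT; apply: contra ny => yL; rewrite yL andbT.
    by apply: contraNneq xI => <-.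
  case/circuit_sub_setU1.
  - exact: indepS (subsetDl _ _) indL.
  - exact: (subsetP IM).
  move=> K KM [eK KL]; exists K => //; split=> //.
    by apply/negP => /(subsetP KL); rewrite !inE eqxx orbF eq_sym (negPf nex).
  by apply: subset_trans KL _; apply: setUS; apply: subsetDl.
have /subsetPn[x xL xI] : ~~ (L \subset I).
  by apply/negP => /subset_leq_card; rewrite leqNgt ltIL.
(* A second exchange, at a point [y] of [Kx] outside [I], yields a circuit [Ky] different from [Kx].
   Both pass through [e], and eliminating [e] leaves a circuit inside [L]. *)
have [|Kx KxM [eKx xKx KxL]] := exchange x; first by rewrite inE xI.
have /subsetPn[y yKx yI] := circI Kx KxM.
have yL : y \in L.
  by have /setU1P[ye|//] := subsetP KxL y yKx; rewrite ye eI in yI.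
have [|Ky KyM [eKy yKy KyL]] := exchange y; first by rewrite inE yI.
have neK : Kx != Ky by apply: contraNneq yKy => <-.
have [|B BM sB] := circuit_elimination KxM KyM neK (e := e).
  by rewrite inE eKx.
have /negP[] := circL B BM; apply/subsetP => z /(subsetP sB).
rewrite !inE => /andP[nze /orP[/(subsetP KxL)|/(subsetP KyL)]];
  by rewrite !inE (negPf nze).
Qed.

Lemma indep_leq_rank A : indep M A -> #|A| <= rank M.
Proof. by move=> indA; apply: (leq_bigmax_cond (F := fun A => #|A|)). Qed.

Lemma indep0 : indep M set0.
Proof.
apply/indepP; split=> [|K KM]; first exact: sub0set.
by rewrite subset0; apply: contraTneq KM => ->; apply: set0_notin_circuits.
Qed.

Lemma rank_attained : exists2 A, indep M A & rank M = #|A|.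
Proof.
have [|A indA eqA] := @eq_bigmax_cond _ (indep M) (fun A => #|A|).
  by apply/card_gt0P; exists set0; apply: indep0.
by exists A.
Qed.

Lemma card_basis B : basis M B -> #|B| = rank M.
Proof.
case/maxsetP=> indB maxB; apply/eqP; rewrite eqn_leq indep_leq_rank //=.
have [J indJ ->] := rank_attained; rewrite leqNgt; apply/negP.
case/(indep_augment indB indJ)=> x /setDP[_ xB] indxB.
have := maxB _ indxB (subsetUr _ _); move/setP/(_ x).
by rewrite !inE eqxx (negPf xB).
Qed.

Lemma rank_leq_ground : rank M <= #|ground M|.
Proof.
by apply/bigmax_leqP => A /indepP[AM _]; apply: subset_leq_card.
Qed.

Lemma nonloop_basis e : e \in ground M -> ~~ loop M e ->
  exists2 B, basis M B & e \in B.
Proof.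
move=> eM nloop; have ind1 : indep M [set e].
  apply/indepP; split=> [|K KM]; first by rewrite sub1set.
  rewrite subset1 negb_or; apply/andP; split.
    by apply: contraNneq nloop => eK; rewrite /loop -eK.
  by apply: contraTneq KM => ->; apply: set0_notin_circuits.
have [B maxB sB] := maxset_exists ind1.
by exists B => //; rewrite -sub1set.
Qed.

Lemma nonbridge_basis e : e \in ground M -> ~~ bridge M e ->
  exists2 B, basis M B & e \notin B.
Proof. by rewrite /bridge => -> /=; rewrite negb_forall_in => /exists_inP. Qed.

(** The family of all circuits contained in [A] can always serve as the witness, so being a cycle
    can be checked point by point. *)
Lemma matroid_cycleP A :
  matroid_cycle M A <->
  forall x, x \in A -> exists2 K, K \in circuits M & x \in K /\ K \subset A.
Proof.
split=> [[S SM ->] x /bigcupP[K KS xK]|circA].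
  exists K; first exact: (subsetP SM).
  by split=> //; apply: (bigcup_max K).
exists [set K in circuits M | K \subset A].
  by apply/subsetP => K; rewrite inE => /andP[].
apply/setP => x; apply/idP/bigcupP => [/circA[K KM [xK KA]]|[K]].
  by exists K; rewrite // inE KM.
by rewrite inE => /andP[_ /subsetP]; apply.
Qed.

Lemma cycle_sub_ground A : matroid_cycle M A -> A \subset ground M.
Proof.
move=> [S SM ->]; apply/bigcupsP => K KS.
exact/circuit_sub_ground/(subsetP SM).
Qed.

End Matroid.

Lemma unique_unionP (T I : finType) (A : I -> {set T}) (s : {set I}) e :
  reflect (exists i, [/\ i \in s, e \in A i
                       & forall j, j \in s -> e \in A j -> j = i])
          (e \in unique_union A s).
Proof.
rewrite inE; apply: (iffP cards1P) => -[i].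
  move=> eqs; have := set11 i; rewrite -eqs inE => /andP[si ei].
  exists i; split=> // j sj ej; apply/set1P; rewrite -eqs inE sj.
  exact: ej.
case=> si ei uniq; exists i; apply/setP => j; rewrite !inE.
by apply/andP/eqP => [[sj ej]|->]; first exact: uniq.
Qed.

(** * Rank, corank and cycles of the 2-sum *)

Section TwoSum.

Variables (T : finType) (M N : matroid T) (p : T).
Hypothesis MNp : ground M :&: ground N = [set p].
Hypotheses (loopM : ~~ loop M p) (loopN : ~~ loop N p).

Let MN := two_sum MNp loopM loopN.

Let pM : p \in ground M.
Proof. by have := set11 p; rewrite -MNp => /setIP[]. Qed.

Let pN : p \in ground N.
Proof. by have := set11 p; rewrite -MNp => /setIP[]. Qed.

Lemma two_sum_left K : K \in circuits M -> p \notin K -> K \in circuits MN.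
Proof. by move=> KM pK; rewrite inE pK andbT; apply: parallel_left. Qed.

Lemma two_sum_right K : K \in circuits N -> p \notin K -> K \in circuits MN.
Proof. by move=> KN pK; rewrite inE pK andbT; apply: parallel_right. Qed.

Lemma two_sum_mixed A B : A \in circuits M -> p \in A -> B \in circuits N ->
  p \in B -> (A :|: B) :\ p \in circuits MN.
Proof.
by move=> AM pA BN pB; rewrite inE [p \in _ :\ _]setD11 andbT parallel_mixed.
Qed.

(** The element [p] is counted on both sides and deleted in the 2-sum, hence the loss of two. *)
Lemma card_two_sum_ground : #|ground MN|.+2 = #|ground M| + #|ground N|.
Proof.
rewrite -cardsUI MNp cards1 addn1; congr _.+1.
by rewrite (cardsD1 p (ground M :|: _)) inE pM.
Qed.

Lemma two_sum_indep_rank I : indep MN I -> #|I| < rank M + rank N.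
Proof.
case/indepP=> sI circI.
have pI : p \notin I by apply/negP => /(subsetP sI); rewrite !inE eqxx.
(* Circuits of either matroid that avoid [p] stay circuits of the 2-sum, so each half of [I] is
   independent. *)
have restrict (L : matroid T) :
    (forall K, K \in circuits L -> p \notin K -> K \in circuits MN) ->
    indep L (I :&: ground L).
  move=> subL; apply/indepP; split=> [|K KL]; first exact: subsetIr.
  apply/negP; rewrite subsetI => /andP[KI _].
  have pK : p \notin K by apply: contra pI => /(subsetP KI).
  by have /negP := circI K (subL K KL pK).
have indM := restrict M two_sum_left; have indN := restrict N two_sum_right.
have cardI : #|I| = #|I :&: ground M| + #|I :&: ground N|.
  rewrite -cardsUI -setIUr setIACA setIid MNp.
  have /setIidPl -> : I \subset ground M :|: ground N.
    exact: subset_trans sI (subsetDl _ _).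
  have -> : I :&: [set p] = set0; last by rewrite cards0 addn0.
  apply/setP => x; rewrite !inE.
  by case: eqP => [->|]; rewrite ?(negPf pI) ?andbF.
have card_p (L : matroid T) : indep L (p |: I :&: ground L) ->
    #|I :&: ground L| < rank L.
  by move/indep_leq_rank; rewrite cardsU1 inE (negPf pI).
rewrite cardI.
have [/card_p ltM|/(circuit_sub_setU1 indM pM)[A AM [pA sA]]] :=
    boolP (indep M (p |: I :&: ground M)).
  by rewrite -addSn leq_add // indep_leq_rank.
have [/card_p ltN|/(circuit_sub_setU1 indN pN)[B BN [pB sB]]] :=
    boolP (indep N (p |: I :&: ground N)).
  by rewrite -addnS leq_add // indep_leq_rank.
have /negP[] := circI _ (two_sum_mixed AM pA BN pB).
apply/subsetP => x; rewrite !inE => /andP[nxp].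
by case/orP=> [/(subsetP sA)|/(subsetP sB)]; rewrite !inE (negPf nxp);
  case/andP.
Qed.

(** Since [p] is in [I], a circuit [A] of [M] lies in [I] as soon as [A :\ p] lies in the union.
    This excludes mixed circuits from the side of [M] alone. *)
Lemma two_sum_indepU I J : indep M I -> p \in I -> indep N J -> p \notin J ->
  indep MN (I :\ p :|: J).
Proof.
case/indepP=> IM circI pI /indepP[JN circJ] pJ.
have sI K : K \in circuits M -> K :\ p \subset I :\ p :|: J -> K \subset I.
  move=> KM /subsetP sK; apply/subsetP => x xK; have [->//|nxp] := eqVneq x p.
  have := sK x; rewrite !inE nxp xK => /(_ isT)/orP[//|xJ].
  by case/eqP: nxp; apply: common_eq MNp (circuit_in KM xK) (subsetP JN x xJ).
apply/indepP; split=> [|K].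
  apply/subsetP => x; rewrite !inE => /orP[/andP[-> /(subsetP IM) ->]//|xJ].
  by rewrite (subsetP JN) // orbT andbT; apply: contraNneq pJ => <-.
rewrite inE => /andP[/parallelP KP pK]; apply/negP => sK.
case: KP => [KM|KN|A B AM pA BN pB eqK].
- have /negP[] := circI K KM; apply: sI => //.
  exact: subset_trans (subsetDl _ _) sK.
- have /negP[] := circJ K KN; apply/subsetP => x xK.
  have := subsetP sK x xK; rewrite !inE => /orP[/andP[nxp xI]|//].
  by case/eqP: nxp; apply: common_eq MNp (subsetP IM x xI) (circuit_in KN xK).
have /negP[] := circI A AM; apply: sI => //; apply: subset_trans sK.
by rewrite eqK setSD // subsetUl.
Qed.

Lemma two_sum_rank : ~~ bridge N p -> (rank MN).+1 = rank M + rank N.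
Proof.
move=> bridgeN; apply/eqP; rewrite eqn_leq; apply/andP; split.
  by have [I indI ->] := rank_attained MN; apply: two_sum_indep_rank.
have [I basI pI] := nonloop_basis pM loopM.
have [J basJ pJ] := nonbridge_basis pN bridgeN.
have [indI indJ] := (maxsetp basI, maxsetp basJ).
have /indep_leq_rank := two_sum_indepU indI pI indJ pJ.
rewrite -(card_basis basI) -(card_basis basJ) [#|I|](cardsD1 p) pI.
rewrite add1n addSn ltnS.
rewrite cardsU; suff -> : (I :\ p) :&: J = set0 by rewrite cards0 subn0.
apply/setP => x; rewrite !inE; apply/negP => /andP[/andP[nxp xI] xJ].
have [[IM _] [JN _]] := (indepP _ _ indI, indepP _ _ indJ).
by case/eqP: nxp; apply: common_eq MNp (subsetP IM x xI) (subsetP JN x xJ).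
Qed.

Lemma two_sum_corank : ~~ bridge N p -> (corank MN).+1 = corank M + corank N.
Proof.
move=> /two_sum_rank rankMN; have := card_two_sum_ground.
have := rank_leq_ground MN; rewrite /corank.
have := rank_leq_ground M; have := rank_leq_ground N.
move=> leN leM leMN cardMN.
(* Adding the ranks back cancels the truncated subtractions, as no rank exceeds the size of its
   ground set. *)
apply: (@addIn (rank M + rank N)).
rewrite addnACA !subnK // -cardMN -rankMN addSn addnS; congr _.+2.
exact: subnK.
Qed.

Lemma two_sum_cycle_left A : matroid_cycle M A -> p \notin A ->
  matroid_cycle MN A.
Proof.
move=> /matroid_cycleP circA pA; apply/matroid_cycleP => x /circA[K KM [xK KA]].
exists K => //; apply: two_sum_left => //.
by apply: contra pA => /(subsetP KA).
Qed.

Lemma two_sum_cycle_right A : matroid_cycle N A -> p \notin A ->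
  matroid_cycle MN A.
Proof.
move=> /matroid_cycleP circA pA; apply/matroid_cycleP => x /circA[K KN [xK KA]].
exists K => //; apply: two_sum_right => //.
by apply: contra pA => /(subsetP KA).
Qed.

(** Fix a circuit through [p] in each of [A] and [B]. Any circuit through [p] on one side is then
    completed by the fixed one on the other side. *)
Lemma two_sum_cycle_mixed A B : matroid_cycle M A -> p \in A ->
  matroid_cycle N B -> p \in B -> matroid_cycle MN ((A :|: B) :\ p).
Proof.
move=> /matroid_cycleP circA pA /matroid_cycleP circB pB.
have [KA KAM [pKA sKA]] := circA p pA; have [KB KBN [pKB sKB]] := circB p pB.
apply/matroid_cycleP => x; rewrite !inE => /andP[nxp /orP[]].
  case/circA=> K KM [xK sK]; have [pK|pK] := boolP (p \in K).
    exists ((K :|: KB) :\ p); first exact: two_sum_mixed.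
    by rewrite !inE nxp xK setSD // setUSS.
  exists K; first exact: two_sum_left.
  by split=> //; rewrite subsetD1 pK andbT subsetU // sK.
case/circB=> K KN [xK sK]; have [pK|pK] := boolP (p \in K).
  exists ((KA :|: K) :\ p); first exact: two_sum_mixed.
  by rewrite !inE nxp xK orbT setSD // setUSS.
exists K; first exact: two_sum_right.
by split=> //; rewrite subsetD1 pK andbT subsetU // sK orbT.
Qed.

End TwoSum.

(** * The cycle system of the 2-sum *)

Theorem proposition3p16 (T : finType) (M N : matroid T) (p : T)
    (MNp : ground M :&: ground N = [set p])
    (loopM : ~~ loop M p) (loopN : ~~ loop N p)
    (bridgeM : ~~ bridge M p) (bridgeN : ~~ bridge N p)
    (g f : nat) (C : 'I_g.+1 -> {set T}) (D : 'I_f.+1 -> {set T})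
    (csC : cycle_system M C) (csD : cycle_system N D)
    (pC1D1 : p \in C ord0 :&: D ord0)
    (pC : p \in unique_union C [set: 'I_g.+1]) :
  let C' (i : 'I_g) := C (lift ord0 i) in
  let D' (j : 'I_f.+1) :=
    if p \notin D j then D j else (C ord0 :|: D j) :\ p in
  let C'D' (k : 'I_g + 'I_f.+1) :=
    match k with inl i => C' i | inr j => D' j end in
  cycle_system (two_sum MNp loopM loopN) C'D'.
Proof.
move=> C' D' C'D'.
have [cardC cycC depC] := csC; have [cardD cycD depD] := csD.
have /setIP[pC0 _] := pC1D1.
have pC' i : p \notin C (lift ord0 i).
  have /unique_unionP[k [_ _ uniq]] := pC; apply/negP => pCi.
  have := neq_lift ord0 i; rewrite (uniq _ (in_setT _) pCi).
  by rewrite (uniq _ (in_setT _) pC0) eqxx.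
have cycC'D' k : matroid_cycle (two_sum MNp loopM loopN) (C'D' k).
  case: k => [i|j] /=; first exact: two_sum_cycle_left (cycC _) (pC' i).
  rewrite /D'; case: ifPn => [pDj|].
    exact: two_sum_cycle_right (cycD j) pDj.
  by rewrite negbK => pDj; apply: two_sum_cycle_mixed.
have CM i e : e \in C i -> e \in ground M.
  exact/subsetP/cycle_sub_ground.
have DN j e : e \in D j -> e \in ground N.
  exact/subsetP/cycle_sub_ground.
(* Away from [p], the set [D' j] agrees with [D j] on [N]; on [M] it is [C ord0] or empty, according
   to whether [p] is in [D j]. *)
have D'N j e : e != p -> e \in ground N -> (e \in D' j) = (e \in D j).
  move=> nep eN; rewrite /D'; case: ifP => // _; rewrite !inE nep.
  case: (boolP (e \in C ord0)) => //= /CM eM.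
  by rewrite (common_eq MNp eM eN) eqxx in nep.
have D'M j e : e != p -> e \in ground M ->
    (e \in D' j) = (p \in D j) && (e \in C ord0).
  move=> nep eM; have eD : (e \in D j) = false.
    by apply: contraNF nep => /DN eN; apply/eqP; apply: common_eq MNp eM eN.
  by rewrite /D'; case: (p \in D j); rewrite /= ?inE eD // nep orbF.
split=> // [|s s0].
  apply: succn_inj; rewrite two_sum_corank // -cardC -cardD.
  by rewrite card_sum !card_ord addSn.
apply/dependentP; split.
  apply/subsetP => e /unique_unionP[k [_ ek _]].
  exact: subsetP (cycle_sub_ground (cycC'D' k)) e ek.
pose sC : {set 'I_g} := inl @^-1: s; pose sD : {set 'I_f.+1} := inr @^-1: s.
(* With no [D j] selected, the circuit given by [depC] avoids [p], because none of the selected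
   [C i] contains [p]. *)
have [sD0|[j sDj]] := set_0Vmem sD.
  have sDF j : (inr j \in s) = false.
    by have := in_set0 j; rewrite -sD0 inE.
  have [|K KM KC] := (dependentP _ _ (depC (lift ord0 @: sC) _)).2.
    have /set0Pn[[i|j] si] := s0; last by rewrite sDF in si.
    by apply/set0Pn; exists (lift ord0 i); rewrite imset_f // inE.
  exists K.
    apply: two_sum_left => //; apply/negP => /(subsetP KC).
    by case/unique_unionP=> _ [/imsetP[i _ ->]]; rewrite (negPf (pC' i)).
  apply/subsetP => e /(subsetP KC)/unique_unionP[_ [/imsetP[i si ->] ei uniq]].
  apply/unique_unionP; exists (inl i); split=> //; first by rewrite inE in si.
  case=> [k sk ek|k]; last by rewrite sDF.
  congr inl; apply: (lift_inj (h := ord0)); apply: uniq => //.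
  by rewrite imset_f // inE.
(* The [C' i] contain no element of [N] other than [p], so they do not disturb uniqueness there. *)
have subD e : e != p -> e \in unique_union D sD -> e \in unique_union C'D' s.
  move=> nep /unique_unionP[k [sk ek uniq]].
  apply/unique_unionP; exists (inr k); split; first by rewrite inE in sk.
    by rewrite /= D'N // (DN k).
  case=> [i _ /= /CM eM|l sl /=].
    by rewrite (common_eq MNp eM (DN k e ek)) eqxx in nep.
  by rewrite (D'N _ _ nep (DN k e ek)) => el; congr inr; apply: uniq;
    rewrite ?inE.
have [|B BN BD] := (dependentP _ _ (depD sD _)).2.
  by apply/set0Pn; exists j.
have [pB|pB] := boolP (p \in B); last first.
  exists B; first exact: two_sum_right.
  apply/subsetP => e eB; apply: subD (subsetP BD e eB).
  by apply: contraNneq pB => <-.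
(* On [M], the set [D' j0] is the only selected copy of [C ord0], so [inr j0] stands in for the
   index [ord0]. *)
have /unique_unionP[j0 [sj0 pj0 uniq0]] := subsetP BD p pB.
have subC e : e != p -> e \in unique_union C (ord0 |: lift ord0 @: sC) ->
    e \in unique_union C'D' s.
  move=> nep /unique_unionP[k [sk ek uniq]]; have eM := CM k e ek.
  case/setU1P: sk => [k0|/imsetP[i si ki]].
    rewrite k0 in ek uniq; apply/unique_unionP; exists (inr j0).
    split; first by rewrite inE in sj0.
      by rewrite /= D'M // pj0.
    case=> [i si ei|l sl /=].
      have : lift ord0 i = ord0.
        by apply: uniq; rewrite ?inE ?imset_f ?orbT ?inE.
      by move/eqP; rewrite eq_sym (negPf (neq_lift _ _)).
    by rewrite D'M // => /andP[pl _]; congr inr; apply: uniq0; rewrite ?inE.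
  rewrite ki in ek uniq; apply/unique_unionP; exists (inl i).
  split=> //; first by rewrite inE in si.
  case=> [l sl el|l sl /=].
    congr inl; apply: (lift_inj (h := ord0)); apply: uniq => //.
    by rewrite inE imset_f ?orbT // inE.
  rewrite D'M // => /andP[_ /uniq]; rewrite setU11 => /(_ isT)/eqP.
  by rewrite (negPf (neq_lift _ _)).
have [|A AM AC] := (dependentP _ _ (depC (ord0 |: lift ord0 @: sC) _)).2.
  by apply/set0Pn; exists ord0; rewrite setU11.
have [pA|pA] := boolP (p \in A); last first.
  exists A; first exact: two_sum_left.
  apply/subsetP => e eA; apply: subC (subsetP AC e eA).
  by apply: contraNneq pA => <-.
(* Both circuits pass through [p]; [subC] and [subD] place what remains of each in the new unique
   union. *)
exists ((A :|: B) :\ p); first exact: two_sum_mixed.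
apply/subsetP => e; rewrite !inE => /andP[nep /orP[eA|eB]].
  by have := subC e nep (subsetP AC e eA); rewrite inE.
by have := subD e nep (subsetP BD e eB); rewrite inE.
Qed.
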